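(* Let $f_1,\dots,f_m:\mathbb{R}^n\to\mathbb{R}$ be differentiable functions with $L$-Lipschitz continuous gradients, and let $x\in\mathbb{R}^n$ be a point at which the central descent direction $V_c(x)$ exists and is nonzero. Let $N=\mathbb{R}^n\setminus\{v\in\mathbb{R}^n:\nabla f_i(x)^Tv\le 0\text{ for all }i=1,\dots,m\}$ be the set of non-descent directions. Then $V_c(x)/\|V_c(x)\|$ is the unit vector maximally distant from $N$; that is, among all $u\in\mathbb{R}^n$ with $\|u\|=1$, the Euclidean distance $\inf_{w\in N}\|u-w\|$ is maximized uniquely at $u=V_c(x)/\|V_c(x)\|$.
   Context: $\|\cdot\|$ is the Euclidean norm. $L$-Lipschitz gradients means that for some $L\ge0$, $\|\nabla f_i(x)-\nabla f_i(y)\|\le L\|x-y\|$ for all $x,y\in\mathbb{R}^n$ and all $i$. Central descent direction: $V_c(x)$ is the unique minimizer of $\tfrac12\|V\|^2$ over all $V\in\mathbb{R}^n$ satisfying $\nabla f_i(x)^T V\le -\|\nabla f_i(x)\|$ for all $i=1,\dots,m$ (it exists whenever at least one such $V$ exists). *)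

(* Defs.v *)
From HB Require Import structures.
From mathcomp Require Import all_boot all_order all_algebra.
From mathcomp Require Import all_classical all_reals all_analysis.

Set Implicit Arguments.
Unset Strict Implicit.
Unset Printing Implicit Defensive.

Import Order.TTheory GRing.Theory Num.Theory.
Import numFieldNormedType.Exports.

Local Open Scope classical_set_scope.
Local Open Scope ring_scope.

(* The library's norm on 'rV[R]_n is the sup norm, hence enorm below. The
   topology and therefore [differentiable] and ['D_v] do not depend on this
   choice. *)

Definition dot (R : realType) (n : nat) (u v : 'rV[R]_n) : R :=
  \sum_(j < n) u 0 j * v 0 j.

Definition enorm (R : realType) (n : nat) (u : 'rV[R]_n) : R :=
  Num.sqrt (dot u u).

Definition edist_to (R : realType) (n : nat) (A : set 'rV[R]_n)
    (u : 'rV[R]_n) : R :=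
  inf [set enorm (u - w) | w in A].

Definition grad (R : realType) (n : nat) (f : 'rV[R]_n -> R)
    (x : 'rV[R]_n) : 'rV[R]_n :=
  \row_j 'D_(delta_mx 0 j) f x.

Definition minimizers (R : realType) (T : Type) (A : set T) (q : T -> R) :
    set T :=
  [set a | A a /\ forall b, A b -> q a <= q b].

Definition maximizers (R : realType) (T : Type) (A : set T) (q : T -> R) :
    set T :=
  [set a | A a /\ forall b, A b -> q b <= q a].

(* V_c(x) is partial, so "V_c(x) exists and equals V" is a relation. *)
Definition is_central_descent (R : realType) (m n : nat)
    (f : 'I_m -> 'rV[R]_n -> R) (x V : 'rV[R]_n) : Prop :=
  minimizers
    [set W | forall i, dot (grad (f i) x) W <= - enorm (grad (f i) x)]
    (fun W => 2^-1 * enorm W ^+ 2) = [set V].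

Definition non_descent (R : realType) (m n : nat)
    (f : 'I_m -> 'rV[R]_n -> R) (x : 'rV[R]_n) : set 'rV[R]_n :=
  ~` [set v | forall i, dot (grad (f i) x) v <= 0].

(* Main.v *)
Require Import Defs.
From mathcomp Require Import all_boot all_order all_algebra.
From mathcomp Require Import all_classical all_reals all_analysis.
From mathcomp Require Import ring lra.
Import Order.TTheory GRing.Theory Num.Theory.
Import numFieldNormedType.Exports.
Local Open Scope classical_set_scope.
Local Open Scope ring_scope.

(** Write [g i] for the gradient of [f i] at [x], so that the non-descent set [N] is
    the complement of the cone of all [v] with [dot (g i) v <= 0] for every
    [i].  The distance from [u] to [N] is how deep [u] lies inside that cone:
    by Cauchy-Schwarz and a step along the normal [g i], a radius [r > 0] is at
    most this distance exactly when [dot (g i) u <= - (r * enorm (g i))] for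
    every [i] ([le_edist_to_setC_cone] and [cone_depth]).  Dividing by [r], this
    says that [u / r] satisfies the constraints that define the central descent
    direction.  For a unit vector [u] the norm of [u / r] is [1 / r], hence a
    unit vector at depth at least [r] is the same thing as a feasible vector of norm
    [1 / r], and maximizing the depth is minimizing the norm.  The feasible
    vector of least norm is [V] and nothing else, so the largest depth is
    [1 / enorm V] and only [V / enorm V] attains it. *)

(** * The Euclidean inner product and norm *)

Section Euclidean.
Context {R : realType} {n : nat}.
Implicit Types (u v w : 'rV[R]_n) (a : R).

Lemma dotC u v : dot u v = dot v u.
Proof. by apply: eq_bigr => j _; rewrite mulrC. Qed.

Lemma dotDr u v w : dot u (v + w) = dot u v + dot u w.
Proof. by rewrite /dot -big_split; apply: eq_bigr => j _; rewrite mxE mulrDr. Qed.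

Lemma dotZr a u v : dot u (a *: v) = a * dot u v.
Proof. by rewrite /dot mulr_sumr; apply: eq_bigr => j _; rewrite mxE mulrCA. Qed.

Lemma dot0r u : dot u 0 = 0.
Proof. by rewrite -(scale0r 0) dotZr mul0r. Qed.

Lemma dot0l u : dot 0 u = 0.
Proof. by rewrite dotC dot0r. Qed.

Lemma dotBr u v w : dot u (v - w) = dot u v - dot u w.
Proof. by rewrite -scaleN1r dotDr dotZr mulN1r. Qed.

Lemma dot_ge0 u : 0 <= dot u u.
Proof. by apply: sumr_ge0 => j _; rewrite -expr2 sqr_ge0. Qed.

Lemma enorm_ge0 u : 0 <= enorm u.
Proof. exact: sqrtr_ge0. Qed.

Lemma enorm_sqr u : enorm u ^+ 2 = dot u u.
Proof. by rewrite sqr_sqrtr // dot_ge0. Qed.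

Lemma enormZ a u : enorm (a *: u) = `|a| * enorm u.
Proof.
rewrite /enorm dotZr dotC dotZr mulrA -expr2 sqrtrM ?sqr_ge0 //.
by rewrite sqrtr_sqr.
Qed.

Lemma enormN u : enorm (- u) = enorm u.
Proof. by rewrite -scaleN1r enormZ normrN1 mul1r. Qed.

Lemma enorm_eq0 u : (enorm u == 0) = (u == 0).
Proof.
apply/eqP/eqP => [u0|->]; last by rewrite /enorm dot0r sqrtr0.
have /eqP : dot u u = 0 by rewrite -enorm_sqr u0 expr0n.
rewrite psumr_eq0 => [/allP uu0|j _]; last by rewrite -expr2 sqr_ge0.
apply/rowP => j; rewrite mxE; apply/eqP.
by have := uu0 j (mem_index_enum j); rewrite /= -expr2 sqrf_eq0.
Qed.

Lemma enorm0 : enorm (0 : 'rV[R]_n) = 0.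
Proof. by apply/eqP; rewrite enorm_eq0. Qed.

Lemma enorm_gt0 u : (0 < enorm u) = (u != 0).
Proof. by rewrite lt0r enorm_ge0 andbT enorm_eq0. Qed.

Lemma enorm_normalize u : u != 0 -> enorm ((enorm u)^-1 *: u) = 1.
Proof.
by move=> u0; rewrite enormZ ger0_norm ?invr_ge0 ?enorm_ge0 // mulVf ?enorm_eq0.
Qed.

(** Cauchy-Schwarz, from the nonnegative square of
    [enorm v *: u - enorm u *: v], which expands to
    [2 * enorm u * enorm v * (enorm u * enorm v - dot u v)]. *)
Lemma dot_le_enorm u v : dot u v <= enorm u * enorm v.
Proof.
have [->|u0] := eqVneq u 0.
  by rewrite dot0l mulr_ge0 ?enorm_ge0.
have [->|v0] := eqVneq v 0.
  by rewrite dot0r mulr_ge0 ?enorm_ge0.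
have uv_gt0 : 0 < enorm u * enorm v by rewrite mulr_gt0 ?enorm_gt0.
have := dot_ge0 (enorm v *: u - enorm u *: v).
rewrite dotBr !dotZr ![dot (_ - _) _]dotC !dotBr !dotZr [dot v u]dotC.
rewrite -!enorm_sqr => sq_ge0.
rewrite -subr_ge0 -(pmulr_rge0 _ uv_gt0); nra.
Qed.

End Euclidean.

(** * Depth inside a polyhedral cone *)

Section Cone.
Context {R : realType} {n : nat} {I : Type} (g : I -> 'rV[R]_n).

Let cone : set 'rV[R]_n := [set v | forall i, dot (g i) v <= 0].

Lemma edist_to_le (A : set 'rV[R]_n) u w : A w -> edist_to A u <= enorm (u - w).
Proof.
move=> Aw; apply: ge_inf; last by exists w.
by exists 0 => _ [z _ <-]; exact: enorm_ge0.
Qed.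

(** Leaving the cone through the constraint [i] means raising [dot (g i) _]
    from at most [- (r * enorm (g i))] to a positive value, which by
    Cauchy-Schwarz takes a displacement of length at least [r].  The complement
    has to be nonempty because the infimum of the empty set is [0]. *)
Lemma le_edist_to_setC_cone u r :
  (~` cone) !=set0 -> (forall i, dot (g i) u <= - (r * enorm (g i))) ->
  r <= edist_to (~` cone) u.
Proof.
move=> [w0 Nw0] deep; apply: lb_le_inf; first by exists (enorm (u - w0)), w0.
move=> _ [w /existsNP[i /negP]] /[swap] <-; rewrite -ltNge => gw.
have cs := dot_le_enorm (g i) (w - u).
have gi_gt0 : 0 < enorm (g i).
  rewrite enorm_gt0; apply/eqP => gi0.
  by move: gw; rewrite gi0 dot0l ltxx.
rewrite -opprB enormN -(ler_pM2l gi_gt0) [_ * r]mulrC.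
apply: le_trans cs; rewrite dotBr.
have := deep i; lra.
Qed.

(** If [u] lay less than [r := edist_to (~` cone) u] below the hyperplane
    normal to [g i], a step of some length [t < r] along the unit normal would
    cross it and reach the complement of the cone. *)
Lemma cone_depth u : 0 < edist_to (~` cone) u ->
  forall i, dot (g i) u <= - (edist_to (~` cone) u * enorm (g i)).
Proof.
set r := edist_to _ u => r_gt0 i.
have [gi0|gi0] := eqVneq (g i) 0.
  by rewrite gi0 dot0l enorm0 mulr0 oppr0.
have gi_gt0 : 0 < enorm (g i) by rewrite enorm_gt0.
set a := enorm (g i) in gi_gt0 *.
rewrite leNgt; apply/negP => shallow.
(* [s] is the signed depth of [u] below the hyperplane; it is negative when
   [u] is already on the other side, where a step of nonnegative length still
   has to be chosen. *)
pose s := - dot (g i) u / a.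
have gu : dot (g i) u = - (s * a) by rewrite /s divfK ?gt_eqF // opprK.
have s_lt_r : s < r by move: shallow; rewrite gu ltrN2 ltr_pM2r.
pose t := (Num.max s 0 + r) / 2.
have max_lt : Num.max s 0 < r by rewrite gt_max s_lt_r.
have s_le : s <= Num.max s 0 by rewrite le_max lexx.
have max_ge0 : 0 <= Num.max s 0 by rewrite le_max lexx orbT.
have [s_lt_t t_ge0 t_lt_r] : [/\ s < t, 0 <= t & t < r].
  by rewrite /t; split; lra.
pose w := u + (t / a) *: g i.
have Nw : (~` cone) w.
  move=> /(_ i); apply/negP; rewrite -ltNge dotDr dotZr -enorm_sqr gu -/a.
  have -> : - (s * a) + t / a * a ^+ 2 = (t - s) * a.
    by field; rewrite gt_eqF.
  by rewrite mulr_gt0 // subr_gt0.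
have := edist_to_le _ u _ Nw; rewrite -/r.
rewrite /w opprD addNKr enormN enormZ.
rewrite (ger0_norm (divr_ge0 t_ge0 (ltW gi_gt0))).
by rewrite divfK ?gt_eqF // leNgt t_lt_r.
Qed.

End Cone.

(** * The maximally distant unit vector *)

(** A nonzero feasible vector [W] normalizes to a unit vector of depth at least
    [1 / enorm W], and a unit vector of depth [r > 0] divided by [r] is a
    feasible vector of norm [1 / r].  The first passage, applied to [V], bounds
    the largest depth from below; the second bounds every depth from above and
    turns uniqueness of the shortest feasible vector into uniqueness of the
    deepest unit vector. *)
Lemma maximizers_edist_to_setC_cone {R : realType} {n : nat} {I : Type}
    (g : I -> 'rV[R]_n) (V : 'rV[R]_n) :
  minimizers [set W | forall i, dot (g i) W <= - enorm (g i)]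
    (fun W => 2^-1 * enorm W ^+ 2) = [set V] ->
  V <> 0 ->
  maximizers [set u : 'rV[R]_n | enorm u = 1]
    (edist_to (~` [set v | forall i, dot (g i) v <= 0]))
  = [set (enorm V)^-1 *: V].
Proof.
set N := ~` _; set F := [set W | _] => minV /eqP V0.
have [FV V_min] : minimizers F (fun W => 2^-1 * enorm W ^+ 2) V by rewrite minV.
have half_sqr_le (W W' : 'rV[R]_n) :
    (2^-1 * enorm W ^+ 2 <= 2^-1 * enorm W' ^+ 2) = (enorm W <= enorm W').
  by rewrite ler_pM2l ?invr_gt0 ?ltr0n // ler_sqr ?nnegrE ?enorm_ge0.
have V_le W : F W -> enorm V <= enorm W.
  by move=> /V_min; rewrite half_sqr_le.
have V_uniq W : F W -> enorm W <= enorm V -> W = V.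
  move=> FW WV; suff : [set V] W by [].
  by rewrite -minV; split=> // W' /V_le VW'; rewrite half_sqr_le (le_trans WV).
have V_gt0 : 0 < enorm V by rewrite enorm_gt0.
(* If every [g i] were in the cone they would all vanish, and the feasible
   vector [0] would be shorter than [V]. *)
have N_neq0 : N !=set0.
  apply/set0P/eqP => N0.
  have F0 : F 0.
    move=> i; have : ~ N (g i) by rewrite N0.
    move=> /contrapT/(_ i); rewrite -enorm_sqr => gi2.
    have gi0 : enorm (g i) = 0.
      by apply/eqP; rewrite -sqrf_eq0 eq_le gi2 sqr_ge0.
    by rewrite dot0r gi0 oppr0.
  by have := V_le _ F0; rewrite enorm0 leNgt V_gt0.
have feasible u : 0 < edist_to N u -> F ((edist_to N u)^-1 *: u).
  move=> r_gt0 i; rewrite dotZr ler_pdivrMl // mulrN.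
  exact: cone_depth.
have normZV u : enorm u = 1 -> 0 < edist_to N u ->
    enorm ((edist_to N u)^-1 *: u) = (edist_to N u)^-1.
  by move=> u1 r_gt0; rewrite enormZ u1 mulr1 ger0_norm // invr_ge0 ltW.
have le_depthV : (enorm V)^-1 <= edist_to N ((enorm V)^-1 *: V).
  apply: le_edist_to_setC_cone => // i.
  by rewrite dotZr -mulrN ler_pM2l ?invr_gt0 //; exact: FV.
have depth_le u : enorm u = 1 -> edist_to N u <= (enorm V)^-1.
  move=> u1; have [r_le0|r_gt0] := leP (edist_to N u) 0.
    by rewrite (le_trans r_le0) // invr_ge0 enorm_ge0.
  by rewrite -[leLHS]invrK lef_pV2 ?posrE ?invr_gt0 // -normZV // V_le //;
    exact: feasible.
apply/seteqP; split => [u [/= u1 u_max]|_ ->]; last first.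
  by split=> [|b b1]; [exact: enorm_normalize
                      | exact: le_trans (depth_le _ b1) le_depthV].
have r_eq : edist_to N u = (enorm V)^-1.
  apply/eqP; rewrite eq_le depth_le //=.
  by apply: le_trans le_depthV _; apply: u_max; exact: enorm_normalize.
have r_gt0 : 0 < edist_to N u by rewrite r_eq invr_gt0.
rewrite /= -(V_uniq _ (feasible _ r_gt0)); last by rewrite normZV // r_eq invrK.
by rewrite normZV // invrK scalerA mulfV ?scale1r ?gt_eqF.
Qed.

Theorem proposition2p4 (R : realType) (m n : nat)
  (f : 'I_m -> 'rV[R]_n -> R) (L : R) (x V : 'rV[R]_n)
  (f_diff : forall (i : 'I_m) (y : 'rV[R]_n), differentiable (f i) y)
  (L_ge0 : 0 <= L)
  (grad_lip : forall (i : 'I_m) (y z : 'rV[R]_n),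
    enorm (grad (f i) y - grad (f i) z) <= L * enorm (y - z))
  (V_central : is_central_descent f x V)
  (V_neq0 : V <> 0) :
  maximizers [set u : 'rV[R]_n | enorm u = 1] (edist_to (non_descent f x))
  = [set (enorm V)^-1 *: V].
Proof. exact: maximizers_edist_to_setC_cone V_central V_neq0. Qed.
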